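(* Let $n\geq 2$ and let $f\in\mathbb{C}[x_1,\dots,x_n]$ be a homogeneous polynomial of degree $d\geq 1$ defining a hypersurface $Z\subset\mathbb{P}^{n-1}$ whose associated reduced hypersurface $Z_{\rm red}$ has only weighted homogeneous isolated singularities. Assume $Z$ is reduced. If there is a nonzero vector field of degree $0$ which annihilates $f$ and whose trace is nonzero, then $f$ is extremely degenerated, that is, after a suitable linear change of coordinates, $f$ is annihilated by a nonzero ''diagonal'' vector field of degree $0$ of the form $\sum_{i=1}^n c_ix_i\partial_{x_i}$ with $c_i\in\mathbb{Q}$.
   Context: A vector field of degree $0$ on $\mathbb{C}^n$ is one of the form $\xi=\sum_{i,j=1}^n c_{i,j}x_i\partial_{x_j}$ with $c_{i,j}\in\mathbb{C}$; it annihilates $f$ if $\xi(f)=0$; its trace is $\sum_i c_{i,i}$. An isolated hypersurface singularity is weighted homogeneous if, in suitable local analytic coordinates, the germ is defined by a weighted homogeneous polynomial (with strictly positive rational weights) having an isolated singularity at the origin. *)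

(* Defs.v *)
(* mpoly must be imported before the analysis files: in the other order their
   notations clash. *)
From mathcomp Require Import all_boot all_order all_algebra.
From mathcomp Require Import mpoly.
From mathcomp Require Import complex.
From mathcomp Require Import boolp classical_sets reals topology normedtype derive.

Set Implicit Arguments.
Unset Strict Implicit.
Unset Printing Implicit Defensive.

Import Order.TTheory GRing.Theory Num.Theory.
Import numFieldNormedType.Exports.

Local Open Scope classical_set_scope.
Local Open Scope ring_scope.

(* The complex numbers, packed as a numClosedFieldType: this is what gives them,
   and the row vectors over them, the normed structures of MathComp-Analysis. *)
Definition Cplx (R : realType) : numClosedFieldType := R[i].

Section Defs.
Variable R : realType.
Local Notation C := (Cplx R).

(* sum_(i,j) c i j * x_i * d/dx_j, applied to f. *)
Definition vfield_app (n : nat) (c : 'M[C]_n) (f : {mpoly C[n]}) : {mpoly C[n]} :=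
  \sum_(i < n) \sum_(j < n) c i j *: ('X_i * f^`M(j)).

Definition lin_subst (n : nat) (A : 'M[C]_n) (f : {mpoly C[n]}) : {mpoly C[n]} :=
  f \mPo [tuple \sum_(j < n) A i j *: 'X_j | i < n].

Definition extremely_degenerated (n : nat) (f : {mpoly C[n]}) : Prop :=
  exists A : 'M[C]_n, A \in unitmx /\
  exists c : 'rV[rat]_n, c != 0 /\
    vfield_app (diag_mx (map_mx ratr c)) (lin_subst A f) = 0.

(* Equation of {f = 0} in the affine chart x_i <> 0 of P^(n-1): x_i is set to 1
   and the other variables are renumbered by 'I_n.-1 (x_(lift i j) becomes x_j). *)
Definition dehomog (n : nat) (i : 'I_n) (f : {mpoly C[n]}) : {mpoly C[n.-1]} :=
  f \mPo [tuple (if unlift i k is Some j then 'X_j else 1) | k < n].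

Section Affine.
Variable m : nat.
Implicit Types (P Q h q : {mpoly C[m]}) (a y : 'rV[C]_m).

Definition mdvd P q : Prop := exists r, q = P * r.

Definition radical_gen P Q : Prop :=
  forall q, mdvd Q q <-> exists k : nat, mdvd P (q ^+ k).

Definition singular_at P a : Prop :=
  P.@[a 0] = 0 /\ forall j : 'I_m, (P^`M(j)).@[a 0] = 0.

Definition isolated_singularity P a : Prop :=
  singular_at P a /\ \forall y \near a, y != a -> ~ singular_at P y.

Definition weighted_homogeneous h : Prop :=
  exists w : 'I_m -> rat, (forall j, 0 < w j) /\
  exists e : rat, forall t : 'X_{1..m}, t \in msupp h ->
    \sum_(j < m) w j * (t j)%:R = e.

(* Differentiability is over C, so this is holomorphy near a. *)
Definition holomorphic_near (V : normedModType C) (F : 'rV[C]_m -> V) a : Prop :=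
  \forall y \near a, differentiable F y.

Definition local_coordinates (phi : 'rV[C]_m -> 'rV[C]_m) a : Prop :=
  [/\ phi 0 = a, holomorphic_near phi 0 &
    exists psi : 'rV[C]_m -> 'rV[C]_m,
      [/\ psi a = 0, holomorphic_near psi a,
          \forall y \near (0 : 'rV[C]_m), psi (phi y) = y &
          \forall x \near a, phi (psi x) = x]].

(* The germs at 0 of P o phi and h generate the same ideal, i.e. they differ by
   the unit u. *)
Definition wh_singularity P a : Prop :=
  exists phi : 'rV[C]_m -> 'rV[C]_m, local_coordinates phi a /\
  exists h : {mpoly C[m]},
    [/\ weighted_homogeneous h, isolated_singularity h 0 &
    exists u : 'rV[C]_m -> C,
      [/\ holomorphic_near u 0, u 0 != 0 &
          \forall y \near (0 : 'rV[C]_m), P.@[phi y 0] = u y * h.@[y 0]]].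

Definition only_wh_isolated_singularities P : Prop :=
  forall a, singular_at P a -> isolated_singularity P a /\ wh_singularity P a.

End Affine.

(* In each standard chart the ideal of Z_red is the radical of that of Z, and
   both the reducedness of Z and the nature of the singularities are local. *)
Definition Zred_only_wh_isolated_singularities (n : nat) (f : {mpoly C[n]}) : Prop :=
  forall i : 'I_n, exists Q : {mpoly C[n.-1]},
    radical_gen (dehomog i f) Q /\ only_wh_isolated_singularities Q.

Definition Z_reduced (n : nat) (f : {mpoly C[n]}) : Prop :=
  forall (i : 'I_n) (q : {mpoly C[n.-1]}) (k : nat),
    mdvd (dehomog i f) (q ^+ k) -> mdvd (dehomog i f) q.

End Defs.

(* Main.v *)
Require Import Defs.
From mathcomp Require Import all_boot all_order all_algebra.
From mathcomp Require Import mpoly.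
From mathcomp Require Import complex.
From mathcomp Require Import boolp classical_sets reals topology normedtype derive.
From mathcomp Require Import spectral.

Set Implicit Arguments.
Unset Strict Implicit.
Unset Printing Implicit Defensive.

Import Order.TTheory GRing.Theory Num.Theory.

Local Open Scope ring_scope.

(* Only the semisimple part of the linear vector field matters. In suitable linear
   coordinates the field has a lower triangular matrix T mixing only coordinates
   with equal eigenvalues. Let g be the polynomial in these coordinates and give
   the i-th coordinate the complex weight T i i. The off-diagonal terms
   x_i d/dx_j (j < i) preserve this weight and strictly raise sum_k k * m_k, so a
   monomial of g of nonzero weight with the smallest such sum would survive in
   the image of g: all monomials of g have weight zero. Since the trace is nonzero
   the weights are not all zero; the linear system they solve has rational
   coefficients, so it also has a nonzero rational solution. *)

(** * Triangular form mixing only equal eigenvalues *)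

Definition eigen_blocked (F : nzRingType) (n : nat) (T : 'M[F]_n) : Prop :=
  forall i j, T i j != 0 -> (j <= i)%N /\ T i i = T j j.

(** Induction step for [eigen_blocked_form]: the outer factors are inverse to each other, so this is
    a conjugation, used to clear the entries of [u] that couple [a] to a different eigenvalue. *)
Lemma eigen_blocked_extend (F : fieldType) (n : nat) (a : F) (u : 'cV[F]_n)
    (T : 'M[F]_n) :
  eigen_blocked T ->
  exists v : 'cV[F]_n,
    eigen_blocked
      (block_mx (1%:M : 'M_1) 0 v 1%:M *m block_mx a%:M 0 u T
         *m block_mx 1%:M 0 (- v) 1%:M).
Proof.
move=> Tb.
(* The conjugate has u + (a%:M - T) v below a, which must vanish outside the rows
   where T has diagonal entry a; adding the projection E onto those rows makes
   a%:M - T invertible. *)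
pose E : 'M[F]_n := \matrix_(i, j) ((i == j) && (T i i == a))%:R.
have Mu : a%:M - T + E \in unitmx.
  rewrite unitmxE det_trig.
    rewrite unitfE; apply/prodf_neq0 => i _; rewrite !mxE !eqxx /= mulr1n.
    have [->|ne] := eqVneq (T i i) a; first by rewrite subrr add0r oner_neq0.
    by rewrite addr0 subr_eq0 eq_sym.
  apply/is_trig_mxP => i j lij; rewrite !mxE.
  have nij : (i == j) = false by apply/negbTE; rewrite neq_ltn lij.
  rewrite nij /= mulr0n addr0 sub0r; apply/eqP; rewrite oppr_eq0.
  by apply/negPn/negP => /Tb []; rewrite leqNgt lij.
have [v Dv] : exists v, v = - invmx (a%:M - T + E) *m u by eexists.
exists v.
(* Solving with the invertible matrix leaves the residue [- (E *m v)], which lives only in the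
   permitted rows. *)
have Ev : v *m a%:M + u - T *m v = - (E *m v).
  have : (a%:M - T + E) *m v = - u.
    by rewrite Dv mulNmx mulmxN mulmxA mulmxV // mul1mx.
  rewrite !mulmxDl mulNmx mul_scalar_mx mul_mx_scalar => e.
  by rewrite -[u]opprK -e !opprD !addrA opprK addrAC addrK subrr sub0r.
rewrite !mulmx_block !(mul1mx, mul0mx, mulmx0, mulmx1, addr0, add0r) mulmxN Ev.
have Ei i : v i 0 *+ (T i i == a) = (E *m v) i 0.
  rewrite mxE (bigD1 i) //= big1 ?addr0 => [|j ne]; rewrite [E _ _]mxE.
    by rewrite eqxx /= mulr_natl.
  by rewrite eq_sym (negbTE ne) mul0r.
move=> i j.
case: (split_ordP i) => i' ->; case: (split_ordP j) => j' ->.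
- by rewrite !ord1.
- by rewrite block_mxEur mxE eqxx.
- rewrite block_mxEdl block_mxEdr block_mxEul !ord1 /= mxE -Ei.
  have [->|] := eqVneq (T i' i') a; first by rewrite mxE eqxx mulr1n.
  by rewrite mulr0n oppr0 eqxx.
- by rewrite !block_mxEdr => /Tb [].
Qed.

(** Induction on [n]: taking a left eigenvector as first basis row makes the first row of the
    conjugate [(a, 0)]. The lower right block is treated by induction, then the column below [a] by
    [eigen_blocked_extend]. *)
Lemma eigen_blocked_form (F : numClosedFieldType) (n : nat) (c : 'M[F]_n) :
  exists B T : 'M[F]_n, [/\ B \in unitmx, B *m c = T *m B & eigen_blocked T].
Proof.
elim: n c => [|n IHn] c.
  by exists 1%:M, c; split; [exact: unitmx1 | rewrite mul1mx mulmx1 | case].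
have [a /eigenvalueP [v va vn0]] := eigenvalue_closed c (ltn0Sn n).
pose e : 'rV[F]_(1 + n) := delta_mx 0 0.
have e0 : e *m ((e^T) *m v) = v.
  rewrite mulmxA /e trmx_delta mul_delta_mx.
  have -> : delta_mx (0 : 'I_1) (0 : 'I_1) = 1%:M :> 'M[F]_1.
    by apply/matrixP => i j; rewrite !mxE !ord1.
  by rewrite mul1mx.
have en0 : e != 0.
  by apply/eqP => /matrixP /(_ 0 0); rewrite !mxE => /eqP; rewrite oner_eq0.
(* The rank-one matrix [e^T *m v] agrees on [e] with an invertible [g], whose first row is thus the
   eigenvector. *)
have [|g gu eg] := @complete_unitmx _ 1 (1 + n) e (e^T *m v).
  by rewrite e0 !rank_rV vn0 en0.
rewrite {}e0 in eg.
have [S DS] : exists S : 'M[F]_(1 + n), S = g *m c *m invmx g by eexists.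
have Se : e *m S = a *: e.
  by rewrite DS !mulmxA -eg va -scalemxAl eg mulmxK.
have Sblk : S = block_mx a%:M 0 (dlsubmx S) (drsubmx S).
  rewrite -[LHS]submxK; congr block_mx.
    apply/matrixP => i j; move/matrixP: Se => /(_ 0 (lshift n j)).
    by rewrite /e -rowE !mxE !ord1 /= mulr1 => <-; congr (S _ _); apply: val_inj.
  apply/matrixP => i j; move/matrixP: Se => /(_ 0 (rshift 1 j)).
  rewrite /e -rowE !mxE ord1 /= mulr0 => <-; congr (S _ _); exact: val_inj.
have [B [T [Bu BT Tb]]] := IHn (drsubmx S).
have [w wb] := eigen_blocked_extend a (B *m dlsubmx S) Tb.
pose W := block_mx (1%:M : 'M[F]_1) 0 w 1%:M.
pose W' := block_mx (1%:M : 'M[F]_1) 0 (- w) 1%:M.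
have W'W : W' *m W = 1%:M.
  rewrite /W /W' mulmx_block !(mul1mx, mul0mx, mulmx0, mulmx1, addr0, add0r) addNr.
  by rewrite -scalar_mx_block.
pose D := block_mx (1%:M : 'M[F]_1) 0 0 B.
(* Three successive base changes: [g] splits off the eigenvector, [D] puts the lower right block in
   form, [W] clears the first column. *)
exists (W *m D *m g), (W *m block_mx a%:M 0 (B *m dlsubmx S) T *m W'); split => //.
- rewrite !unitmx_mul gu andbT; apply/andP; split; last first.
    by rewrite unitmxE /D (@det_lblock _ 1) det1 mul1r -unitmxE.
  by rewrite unitmxE /W (@det_lblock _ 1) !det1 mul1r unitr1.
- have gc : g *m c = S *m g by rewrite DS mulmxKV.
  rewrite -[LHS]mulmxA gc [LHS]mulmxA [RHS]mulmxA; congr (_ *m g).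
  rewrite [RHS]mulmxA -[X in _ = X *m D]mulmxA W'W mulmx1 -!mulmxA; congr (_ *m _).
  rewrite Sblk !mulmx_block !(mul1mx, mul0mx, mulmx0, mulmx1, addr0, add0r).
  by rewrite block_mxKdl BT.
Qed.

(** * Weights of monomials and coefficients of derivatives *)

(** The values lie in any [nmodType] because three cases occur: complex eigenvalues, rational
    solutions, and the natural number sum of k * m_k that drives the induction. *)
Definition weight (V : nmodType) (n : nat) (a : 'I_n -> V) (m : 'X_{1..n}) : V :=
  \sum_i a i *+ m i.

Lemma weight_addU (V : nmodType) (n : nat) (a : 'I_n -> V) (m : 'X_{1..n}) (i : 'I_n) :
  weight a (m + U_(i))%MM = weight a m + a i.
Proof.
rewrite /weight; under eq_bigr => k _ do rewrite mnmDE mulrnDr mnm1E.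
rewrite big_split /=; congr (_ + _).
rewrite (bigD1 i) //= eqxx mulr1n big1 ?addr0 // => k.
by rewrite eq_sym => /negbTE ->.
Qed.

Lemma submUK (n : nat) (m : 'X_{1..n}) (i : 'I_n) :
  (0 < m i)%N -> (m - U_(i) + U_(i))%MM = m.
Proof.
by move=> mi; rewrite submK //; apply/mnm_lepP => k; rewrite mnm1E; case: eqP => // <-.
Qed.

(** The test [0 < m i] is there because subtraction of multi-indices truncates at zero. *)
Lemma mcoeffUM (F : comNzRingType) (n : nat) (p : {mpoly F[n]}) (i : 'I_n)
    (m : 'X_{1..n}) :
  ('X_i * p)@_m = if (0 < m i)%N then p@_(m - U_(i))%MM else 0.
Proof.
case: ifP => mi.
  by rewrite -{1}(submUK mi) addmC mulrC mcoeffMX.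
rewrite [p]mpolyE mulr_sumr raddf_sum big1 //= => k _.
rewrite -scalerAr -mpolyXD mcoeffZ mcoeffX.
case: eqP => [e|]; last by rewrite mulr0.
by move: mi; rewrite -e mnmDE mnm1E eqxx.
Qed.

Lemma mcoeffU_deriv (F : comNzRingType) (n : nat) (p : {mpoly F[n]}) (i j : 'I_n)
    (m : 'X_{1..n}) :
  ('X_i * p^`M(j))@_m =
    if (0 < m i)%N then p@_(m - U_(i) + U_(j))%MM *+ ((m - U_(i))%MM j).+1 else 0.
Proof. by rewrite mcoeffUM mcoeff_deriv. Qed.

Lemma mcoeffU_deriv_diag (F : comNzRingType) (n : nat) (p : {mpoly F[n]})
    (i : 'I_n) (m : 'X_{1..n}) :
  ('X_i * p^`M(i))@_m = p@_m *+ m i.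
Proof.
rewrite mcoeffU_deriv; case: posnP => [->|mi]; first by rewrite mulr0n.
by rewrite submUK // mnmBE mnm1E eqxx subn1 prednK.
Qed.

Lemma mpolyX_ind (F : comNzRingType) (n : nat) (P : {mpoly F[n]} -> Prop)
    (t : 'X_{1..n}) :
  P 1 -> (forall r s, P r -> P s -> P (r * s)) -> (forall i, P 'X_i) -> P 'X_[t].
Proof.
move=> P1 PM PX; rewrite mpolyXE_id.
elim/big_rec: _ => // i x _; apply: (PM).
by elim: (t i) => [|e IHe]; rewrite ?expr0 ?exprS //; exact: PM.
Qed.

(** Chain rule: as functions of [p] both sides are linear and satisfy the Leibniz rule along the
    substitution, so it suffices to compare them on the variables. *)
Lemma mderiv_comp (F : comNzRingType) (n m : nat) (q : n.-tuple {mpoly F[m]})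
    (p : {mpoly F[n]}) (j : 'I_m) :
  (p \mPo q)^`M(j) = \sum_(k < n) (p^`M(k) \mPo q) * (tnth q k)^`M(j).
Proof.
pose P (r : {mpoly F[n]}) :=
  (r \mPo q)^`M(j) = \sum_(k < n) (r^`M(k) \mPo q) * (tnth q k)^`M(j).
have PM r s : P r -> P s -> P (r * s).
  rewrite /P rmorphM /= mderivM => -> ->.
  rewrite mulr_suml mulr_sumr -big_split /=; apply: eq_bigr => k _.
  by rewrite mderivM rmorphD !rmorphM /= mulrDl mulrAC mulrA.
have P1 : P 1.
  rewrite /P rmorph1 -[X in X^`M(_)]mpolyC1 mderivC big1 // => k _.
  by rewrite -mpolyC1 mderivC raddf0 mul0r.
have PX k : P 'X_k.
  rewrite /P comp_mpolyXU -tnth_nth (bigD1 k) //= big1 ?addr0.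
    rewrite mderivX mnm1E eqxx scale1r.
    have -> : (U_(k) - U_(k))%MM = 0%MM by apply/mnmP => l; rewrite mnmBE mnm0E subnn.
    by rewrite mpolyX0 rmorph1 mul1r.
  move=> l; rewrite eq_sym => /negbTE ne.
  by rewrite mderivX mnm1E ne scale0r raddf0 mul0r.
elim/mpolyind: p => [|c t r _ _ IHr].
  by rewrite raddf0 mderiv0 big1 // => k _; rewrite mderiv0 raddf0 mul0r.
have PXt : P 'X_[t] by exact: mpolyX_ind.
rewrite comp_mpolyD comp_mpolyZ mderivD mderivZ IHr PXt scaler_sumr -big_split /=.
apply: eq_bigr => k _.
by rewrite mderivD mderivZ comp_mpolyD comp_mpolyZ mulrDl scalerAl.
Qed.

(** * Linear vector fields: coordinate changes and weights of the support *)

Section Fields.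
Variable R : realType.
Local Notation C := (Cplx R).

(** In terms of the products of x_i with the substituted partials of [f], the chain rule gives the
    left side the coefficients [T *m A^T]; expanding the substituted variables gives the right side
    [A^T *m c]. *)
Lemma vfield_lin_subst (n : nat) (A T c : 'M[C]_n) (f : {mpoly C[n]}) :
  T *m A^T = A^T *m c -> vfield_app T (lin_subst A f) = lin_subst A (vfield_app c f).
Proof.
move=> eTA; rewrite /vfield_app /lin_subst.
set q := [tuple _ | i < n].
have dq k j : (tnth q k)^`M(j) = (A k j)%:MP.
  rewrite tnth_mktuple raddf_sum (bigD1 j) //= big1 ?addr0.
    rewrite mderivZ mderivX mnm1E eqxx scale1r.
    have -> : (U_(j) - U_(j))%MM = 0%MM by apply/mnmP => l; rewrite mnmBE mnm0E subnn.
    by rewrite mpolyX0 -mul_mpolyC mulr1.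
  by move=> l /negbTE ne; rewrite mderivZ mderivX mnm1E ne scale0r scaler0.
rewrite raddf_sum /=.
under [RHS]eq_bigr => i _ do rewrite raddf_sum /=.
under [RHS]eq_bigr => i _ do under eq_bigr => j _ do
  rewrite comp_mpolyZ rmorphM /= comp_mpolyXU -tnth_nth tnth_mktuple mulr_suml scaler_sumr.
under [LHS]eq_bigr => i _ do under eq_bigr => j _ do
  rewrite mderiv_comp mulr_sumr scaler_sumr.
have -> : \sum_(i < n) \sum_(j < n) \sum_(k < n)
     T i j *: ('X_i * ((f^`M(k) \mPo q) * (tnth q k)^`M(j)))
   = \sum_(i < n) \sum_(k < n) (T *m A^T) i k *: ('X_i * (f^`M(k) \mPo q)).
  apply: eq_bigr => i _; rewrite exchange_big /=; apply: eq_bigr => k _.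
  rewrite mxE scaler_suml; apply: eq_bigr => j _.
  by rewrite dq mxE mulrA -[X in _ *: X]mulrC mul_mpolyC scalerA.
rewrite eTA.
transitivity (\sum_(i < n) \sum_(k < n) \sum_(l < n)
    (A l i * c l k) *: ('X_i * (f^`M(k) \mPo q))).
  apply: eq_bigr => i _; apply: eq_bigr => k _; rewrite mxE scaler_suml.
  by apply: eq_bigr => l _; rewrite mxE.
rewrite [RHS]exchange_big.
rewrite [LHS]exchange_big /=; apply: eq_bigr => k _.
rewrite [LHS]exchange_big /=; apply: eq_bigr => l _; apply: eq_bigr => i _.
by rewrite -scalerAl scalerA mulrC.
Qed.

Lemma mcoeff_vfield_diag (n : nat) (c : 'rV[C]_n) (g : {mpoly C[n]}) (m : 'X_{1..n}) :
  (vfield_app (diag_mx c) g)@_m = weight (c 0) m * g@_m.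
Proof.
rewrite /vfield_app raddf_sum /= /weight mulr_suml; apply: eq_bigr => i _.
rewrite raddf_sum /= (bigD1 i) //= big1 ?addr0.
  by rewrite mcoeffZ mcoeffU_deriv_diag mxE eqxx mulr1n mulrnAl mulrnAr.
by move=> j; rewrite eq_sym mxE => /negbTE ->; rewrite mulr0n scale0r mcoeff0.
Qed.

Lemma eigen_blocked_weight0 (n : nat) (T : 'M[C]_n) (g : {mpoly C[n]})
    (m : 'X_{1..n}) :
  eigen_blocked T -> vfield_app T g = 0 -> m \in msupp g ->
  weight (fun i => T i i) m = 0.
Proof.
move=> Tb Tg; rewrite mcoeff_msupp; apply: contraNeq.
have [h] := ubnP (weight (@nat_of_ord n) m).
elim: h m => // h IHh m; rewrite ltnS => mh wm.
have := congr1 (mcoeff m) Tg; rewrite mcoeff0 /vfield_app raddf_sum /=.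
have -> : \sum_(i < n) (\sum_(j < n) T i j *: ('X_i * g^`M(j)))@_m
   = weight (fun i => T i i) m * g@_m.
  rewrite /weight mulr_suml; apply: eq_bigr => i _.
  rewrite raddf_sum /= (bigD1 i) //= big1 ?addr0.
    by rewrite mcoeffZ mcoeffU_deriv_diag mulrnAl mulrnAr.
  (* This term reads the coefficient of [g] at [m - U_(i) + U_(j)], which has the same nonzero
     weight and, as j < i, a smaller sum of k * m_k; by induction it vanishes. *)
  move=> j ne; rewrite mcoeffZ mcoeffU_deriv.
  have [->|/Tb [lji eT]] := eqVneq (T i j) 0; first by rewrite mul0r.
  case: posnP => [_|mi]; first by rewrite mulr0.
  rewrite -(submUK mi) !weight_addU in mh wm; rewrite eT in wm.
  rewrite (eqP (IHh _ _ _)) ?mul0rn ?mulr0 // weight_addU //.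
  apply: leq_trans mh; rewrite -addnS leq_add2l.
  by rewrite ltn_neqAle lji andbT (inj_eq val_inj).
by move/eqP; rewrite mulf_eq0 (negbTE wm).
Qed.

(** The rank of the exponent matrix is the same over the rationals and over [C], so the nonzero
    complex solution [a] excludes full row rank over the rationals too. *)
Lemma rational_weights (n : nat) (s : seq 'X_{1..n}) (a : 'I_n -> C) :
  (exists i, a i != 0) -> {in s, forall m, weight a m = 0} ->
  exists2 c : 'rV[rat]_n, c != 0 & {in s, forall m, weight (c 0) m = 0}.
Proof.
move=> [i0 ai0] sa.
pose M : 'M[rat]_(n, size s) := \matrix_(i, k) ((nth 0%MM s k) i)%:R.
have : ~~ row_free M.
  rewrite -(row_free_map (ratr : {rmorphism rat -> C})).
  apply/negP => /row_freeP [N MN].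
  pose v : 'rV[C]_n := \row_i a i.
  have vM : v *m map_mx ratr M = 0.
    apply/rowP => k; rewrite !mxE -[RHS](sa (nth 0%MM s k)) ?mem_nth //.
    by apply: eq_bigr => i _; rewrite !mxE ratr_nat mulr_natr.
  have : v *m (map_mx ratr M *m N) = 0 by rewrite mulmxA vM mul0mx.
  rewrite MN mulmx1 => /rowP /(_ i0); rewrite !mxE => ai.
  by rewrite ai eqxx in ai0.
rewrite -kermx_eq0 => /rowV0Pn [c /sub_kermxP cM cn0]; exists c => // m ms.
move/rowP: cM => /(_ (Ordinal (etrans (index_mem m s) ms))).
rewrite !mxE => <-; apply: eq_bigr => i _.
by rewrite !mxE /= nth_index // mulr_natr.
Qed.
End Fields.

Theorem corollary1 (R : realType) (n : nat) (hn : (2 <= n)%N)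
    (d : nat) (hd : (1 <= d)%N) (f : {mpoly (Cplx R)[n]})
    (f_neq0 : f != 0) (f_homog : f \is d.-homog)
    (f_sing : Zred_only_wh_isolated_singularities f)
    (f_red : Z_reduced f)
    (c : 'M[Cplx R]_n) (c_neq0 : c != 0)
    (c_ann : vfield_app c f = 0) (c_tr : \tr c != 0) :
  extremely_degenerated f.
Proof.
have [B [T [Bu BT Tb]]] := eigen_blocked_form c.
(* The transpose matches the [A^T] in [vfield_lin_subst]. *)
pose g := lin_subst B^T f.
have Tg : vfield_app T g = 0.
  by rewrite /g (@vfield_lin_subst _ _ _ _ c) ?trmxK // c_ann /lin_subst raddf0.
(* The trace is invariant under conjugation, so the diagonal of [T] cannot vanish. *)
have [i Ti] : exists i, T i i != 0.
  apply/existsP; apply: contraNT c_tr; rewrite negb_exists => /forallP T0.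
  have -> : c = invmx B *m (T *m B) by rewrite -BT mulKmx.
  rewrite mxtrace_mulC mulmxK //; apply/eqP/big1 => i _.
  by apply/eqP; have := T0 i; rewrite negbK.
have [|w wn0 wg] := @rational_weights R n (msupp g) (fun i => T i i) (ex_intro _ i Ti).
  by move=> m; exact: eigen_blocked_weight0.
exists B^T; split; first by rewrite unitmx_tr.
exists w; split; first exact: wn0.
apply/mpolyP => m; rewrite mcoeff0 mcoeff_vfield_diag.
have [mg|/memN_msupp_eq0 ->] := boolP (m \in msupp g); last by rewrite mulr0.
have -> : weight (map_mx ratr w 0) m = ratr (weight (w 0) m) :> Cplx R.
  by rewrite /weight rmorph_sum; apply: eq_bigr => k _; rewrite mxE rmorphMn.
by rewrite wg // rmorph0 mul0r.
Qed.
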